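(* The following statements are equivalent for every graph $G$: (i) $G$ is a path-bipartite graph of sets $A$ and $B$ whenever $A$ and $B$ are disjoint nonempty subsets of $V(G)$ such that $V(G)=A\cup B$. (ii) $G$ is connected and the equality $G'=G$ holds.
   Context: All graphs are simple: a graph $G$ is a pair consisting of a nonempty vertex set $V(G)$ and a set $E(G)$ of edges, which are unordered pairs of different elements of $V(G)$; graphs may be of arbitrary cardinality. A vertex is isolated if no vertex is adjacent to it. A graph is empty if $E(G)=\varnothing$. If $G$ is a nonempty graph, $G'$ denotes the subgraph of $G$ whose vertices are the non-isolated vertices of $G$ and for which $E(G')=E(G)$. Since $G'$ is defined only for nonempty $G$, the equality $G'=G$ means that $G$ is nonempty and has no isolated vertices. A path is a finite nonempty graph $P$ whose (distinct) vertices can be numbered so that $V(P)=\{u_0,u_1,\dots,u_k\}$, $k\ge 1$, and $E(P)=\{\{u_0,u_1\},\dots,\{u_{k-1},u_k\}\}$; it joins $u_0$ and $u_k$. A graph $G$ is connected if for every two distinct $u,v\in V(G)$ there is a path $P\subseteq G$ joining $u$ and $v$. Let $A$ and $B$ be two nonempty disjoint sets. A path $P$ is a be-path of $A$ and $B$ if $V(P)\subseteq A\cup B$ and there is a unique edge $\{a_0,b_0\}\in E(P)$ for which $A\cap\{a_0,b_0\}\neq\varnothing\neq B\cap\{a_0,b_0\}$. A graph $G$ with $A,B\subseteq V(G)$ is a path-bipartite graph of $A$ and $B$ if $G$ is the union (union of vertex sets and union of edge sets) of a nonempty set of be-paths of $A$ and $B$.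
   Formalization: Graphs with exactly one vertex are excluded: for them (i) holds vacuously, since V(G) has no partition into two nonempty sets, while (ii) fails because G has no edge and so G' = G does not hold. *)

(* Defs.v *)
From mathcomp Require Import all_boot.
From mathcomp Require Import boolp classical_sets.

Set Implicit Arguments.
Unset Strict Implicit.
Unset Printing Implicit Defensive.

Local Open Scope classical_set_scope.

(* The vertex set is an arbitrary nonempty subset of an ambient type [U], so
   that a graph, its subgraphs and its paths are objects of the same type; an
   edge is an unordered pair, i.e. a two-element set of vertices. *)
Record graph (U : Type) := Graph {
  vset : set U;
  eset : set (set U);
  vset_nonempty : vset !=set0;
  eset_pair : forall e, eset e ->
    exists x y, [/\ vset x, vset y, x <> y & e = [set x; y]]
}.

Section Graphs.
Variable U : Type.
Implicit Types (G H P : graph U) (A B : set U).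

Definition adjacent G (x y : U) : Prop := eset G [set x; y].

Definition isolated G (x : U) : Prop := forall y, vset G y -> ~ adjacent G x y.

Definition nonempty_graph G : Prop := eset G !=set0.

Definition noniso_vset G : set U := [set x | vset G x /\ ~ isolated G x].

Lemma edge_noniso G e : eset G e ->
  exists x y, [/\ noniso_vset G x, noniso_vset G y, x <> y & e = [set x; y]].
Proof.
move=> eG; have [x [y [xG yG xy exy]]] := eset_pair eG.
exists x, y; split=> //; split=> // iso.
- by apply: (iso y yG); rewrite /adjacent -exy.
- by apply: (iso x xG); rewrite /adjacent setUC -exy.
Qed.

Lemma noniso_nonempty G : nonempty_graph G -> noniso_vset G !=set0.
Proof. by move=> [e /edge_noniso[x [_ [xG _ _ _]]]]; exists x. Qed.

(* The graph G' obtained by deleting the isolated vertices; it depends on a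
   proof that G has an edge, being undefined otherwise. *)
Definition noniso_graph G (nG : nonempty_graph G) : graph U :=
  Graph (noniso_nonempty nG) (@edge_noniso G).

Definition noniso_graph_eq G : Prop :=
  exists nG : nonempty_graph G, noniso_graph nG = G.

Definition subgraph H G : Prop :=
  vset H `<=` vset G /\ eset H `<=` eset G.

(* [u 0, ..., u k] numbers the vertices of the path P; the values of [u] beyond
   [k] are irrelevant. *)
Definition path_numbering P (k : nat) (u : nat -> U) : Prop :=
  [/\ (1 <= k)%N,
      {in `I_k.+1 &, injective u},
      vset P = [set u i | i in `I_k.+1] &
      eset P = [set [set u i; u i.+1] | i in `I_k] ].

Definition is_path P : Prop := exists k u, path_numbering P k u.

Definition joins P (x y : U) : Prop :=
  exists k u, [/\ path_numbering P k u, u 0%N = x & u k = y].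

Definition connected_graph G : Prop :=
  forall x y, vset G x -> vset G y -> x <> y ->
    exists P, subgraph P G /\ joins P x y.

Definition be_path A B P : Prop :=
  [/\ is_path P,
      vset P `<=` A `|` B &
      exists! e, [/\ eset P e, A `&` e !=set0 & B `&` e !=set0] ].

Definition is_union_graph G (F : set (graph U)) : Prop :=
  vset G = \bigcup_(P in F) vset P /\ eset G = \bigcup_(P in F) eset P.

Definition path_bipartite G A B : Prop :=
  [/\ A `<=` vset G, B `<=` vset G &
      exists F : set (graph U),
        [/\ F !=set0, F `<=` be_path A B & is_union_graph G F] ].

End Graphs.

(* Main.v *)
(** If every partition of V(G) is path-bipartite, every vertex lies on a path and
    so on an edge; splitting off the set of vertices reachable from x would leave
    no edge for a be-path to cross with, so G is connected. Conversely, for an edge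
    xy inside A, a shortest walk from {x, y} to B meets {x, y} only at its start and
    B only at its end, so putting the other endpoint of xy in front of it gives a
    be-path through xy. *)

Require Import Defs.
From mathcomp Require Import all_boot.
From mathcomp Require Import boolp classical_sets.
From mathcomp Require Import zify.

Local Open Scope classical_set_scope.

Set Implicit Arguments.
Unset Strict Implicit.

Section Walks.
Variables (U : Type) (G : graph U).
Implicit Types (A B S T : set U) (P : graph U) (u : nat -> U).

(** Vertices may repeat and only [u 0], ..., [u k] matter. For [k = 0] there is no condition, so a
    walk of length zero does not certify that its vertex lies in [G]. *)
Definition walk k u : Prop :=
  forall i, (i < k)%N -> adjacent G (u i) (u i.+1).

Definition walk_between S T k : Prop :=
  exists u, [/\ walk k u, S (u 0%N) & T (u k)].

(** Excise the closed stretch between the two visits [i] and [j] to the same vertex. *)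
Lemma walk_cut S T k u i j : walk k u -> S (u 0%N) -> T (u k) ->
  (i < j)%N -> (j <= k)%N -> u i = u j -> walk_between S T (k - (j - i)).
Proof.
move=> wu Su Tu ij jk uij.
exists (fun n => if (n <= i)%N then u n else u (n + (j - i))%N); split.
- move=> n nk; case: (ltngtP n i) => ni; [apply: wu; lia| |].
  + by rewrite addSn; apply: wu; lia.
  + by rewrite ni uij addSn subnKC ?(ltnW ij)//; apply: wu; lia.
- by [].
(* The shortened walk ends at an index at most [i] only if [j = k]; its end is then
   [u i = u j = u k]. *)
- case: ifP => h; last by rewrite subnK//; lia.
  have -> : (k - (j - i) = i)%N by lia.
  by rewrite uij; have <- : k = j by lia.
Qed.

(** Minimal length suffices: a repetition could be cut out, a later visit to [S] would allow a later
    start, and an earlier visit to [T] an earlier stop. *)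
Lemma shortest_walk S T k0 : walk_between S T k0 ->
  exists k u, [/\ walk k u, {in `I_k.+1 &, injective u}, S (u 0%N) /\ T (u k),
    forall i, (0 < i <= k)%N -> ~ S (u i) & forall i, (i < k)%N -> ~ T (u i)].
Proof.
move=> w0; have ex : exists k, `[< walk_between S T k >] by exists k0; apply/asboolP.
case: (ex_minnP ex) => k /asboolP [u [wu Su Tu]] kmin.
have {}kmin m : (m < k)%N -> ~ walk_between S T m.
  by move=> mk wm; have := kmin m (asboolT wm); lia.
have neq i j : (i < j)%N -> (j <= k)%N -> u i <> u j.
  move=> ij jk uij; have := walk_cut wu Su Tu ij jk uij.
  by apply: kmin; lia.
exists k, u; split=> //.
- move=> i j; rewrite !inE /= => ik jk uij.
  by case: (ltngtP i j) => // ij; [case: (neq i j ij)|case: (neq j i ij)].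
- move=> i /andP[i0 ik] Sui; apply: (kmin (k - i)); first lia.
  exists (fun n => u (n + i)%N); rewrite add0n subnK//; split=> // n nk.
  by rewrite addSn; apply: wu; lia.
- move=> i ik Tui; apply: (kmin i) => //.
  by exists u; split=> // n ni; apply: wu; lia.
Qed.

Lemma edge_vset e x : eset G e -> e x -> vset G x.
Proof. by move=> /eset_pair[a [b [aG bG _ ->]]] [->|->]. Qed.

Lemma adjacentC x y : adjacent G x y -> adjacent G y x.
Proof. by rewrite /adjacent setUC. Qed.

Lemma adjacent_neq x y : adjacent G x y -> x <> y.
Proof.
move=> /eset_pair[a [b [_ _ ab exy]]] xy; rewrite -xy setUid in exy.
have ax : a = x by have : [set x] a by rewrite exy; left.
have bx : b = x by have : [set x] b by rewrite exy; right.
by apply: ab; rewrite ax bx.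
Qed.

Lemma path_of_walk k u : (1 <= k)%N -> walk k u -> {in `I_k.+1 &, injective u} ->
  exists P, path_numbering P k u /\ subgraph P G.
Proof.
move=> k1 wu uinj.
have V0 : [set u i | i in `I_k.+1] !=set0 by exists (u 0%N), 0%N.
have Ep e : [set [set u i; u i.+1] | i in `I_k] e -> exists x y,
    [/\ [set u i | i in `I_k.+1] x, [set u i | i in `I_k.+1] y, x <> y & e = [set x; y]].
  move=> [i /= ik <-]; exists (u i), (u i.+1); split=> //.
  - by exists i => //=; lia.
  - by exists i.+1.
  - exact: adjacent_neq (wu _ ik).
exists (Graph V0 Ep); split; first by split.
split=> [_ [i /= ik <-]|_ [i /= ik <-]]; last exact: wu.
case: (ltngtP i k) => ik'; [|lia|].
- by apply: (edge_vset (wu _ ik')); left.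
(* The last vertex starts no step, so it is reached as the far end of the preceding edge. *)
- have k1k : (k.-1 < k)%N by lia.
  by apply: (edge_vset (wu _ k1k)); right; rewrite prednK// ik'.
Qed.

(** All edges before the last have both ends in [A], so only the last one can meet [B]. The first
    edge is singled out because it is the one to be covered. *)
Lemma be_path_of_walk A B k u : A `&` B = set0 -> walk k.+1 u ->
  {in `I_k.+2 &, injective u} -> (forall i, (i <= k)%N -> A (u i)) -> B (u k.+1) ->
  exists P, [/\ be_path A B P, subgraph P G & eset P [set u 0%N; u 1%N]].
Proof.
move=> AB wu uinj uA uB.
have [P [nP sP]] := path_of_walk (ltn0Sn k) wu uinj.
exists P; split=> //; case: (nP) => _ _ VP EP; last by rewrite EP; exists 0%N.
have uAB i : (i <= k)%N -> ~ B (u i).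
  by move=> ik Bi; have : (A `&` B) (u i) by [split=> //; exact: uA]; rewrite AB.
split; first by exists k.+1, u.
- rewrite VP => _ [i /= ik <-]; case: (ltngtP i k.+1) => h; [|lia|].
  + by left; apply: uA; lia.
  + by right; rewrite h.
- exists [set u k; u k.+1]; split.
  + split; first by rewrite EP; exists k => /=.
    * by exists (u k); split; [exact: uA|left].
    * by exists (u k.+1); split; [|right].
  + move=> e [+ _ [b [Bb]]]; rewrite EP => -[i /= ik <-] h.
    suff -> : i = k by [].
    apply/eqP; case: (ltngtP i k) => // ik'; last lia.
    by case: h Bb => -> /uAB; case; lia.
Qed.

Lemma connected_walk x y : connected_graph G -> vset G x -> vset G y ->
  exists k, walk_between [set x] [set y] k.
Proof.
move=> cG xG yG; have [->|xy] := pselect (x = y); first by exists 0%N, (fun=> y).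
have [P [[_ sE] [k [u [[_ _ _ EP] u0 uk]]]]] := cG x y xG yG xy.
exists k, u; split=> // i ik; apply: sE; rewrite EP; by exists i.
Qed.

Lemma be_path_through A B x y : connected_graph G -> vset G = A `|` B ->
  A `&` B = set0 -> B !=set0 -> A x -> adjacent G x y ->
  exists P, [/\ be_path A B P, subgraph P G & eset P [set x; y]].
Proof.
move=> cG VG AB [b Bb] Ax xy.
have yG : vset G y by apply: (edge_vset xy); right.
(* A crossing edge is a be-path by itself. *)
have [By|nBy] := pselect (B y).
  have neq := adjacent_neq xy.
  apply: (@be_path_of_walk A B 0 (fun n => if n is 0%N then x else y)) => //.
  - by case.
  - move=> [|[|i]] [|[|j]]; rewrite !inE //=.
    by move=> _ _ /esym/neq.
  - by case.
have Ay : A y by move: yG; rewrite VG => -[].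
have [||k0 [v [wv v0 vk]]] := @connected_walk x b cG; [by rewrite VG; left|by rewrite VG; right|].
(* Starting from the pair rather than from [x] lets minimality choose the end of the edge nearer to
   [B], which keeps the other end [z] off the walk. *)
have w0 : walk_between [set x; y] B k0 by exists v; split=> //; [left|rewrite vk].
have [k [u [wu uinj [Su Bu] nS nB]]] := shortest_walk w0.
have [z [Az xyE]] : exists z, A z /\ [set x; y] = [set z; u 0%N].
  by case: Su => ->; [exists y; rewrite setUC|exists x].
have zu : adjacent G z (u 0%N) by rewrite /adjacent -xyE.
have zneq i : (i <= k)%N -> z <> u i.
  case: i => [|i] ik; first exact: adjacent_neq.
  move=> zi; apply: (nS i.+1); first lia.
  by rewrite xyE -zi; left.
have uG i : (i <= k)%N -> vset G (u i).
  case: (ltngtP i k) => // ik _; first by apply: (edge_vset (wu _ ik)); left.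
  by rewrite ik VG; right.
rewrite xyE.
apply: (@be_path_of_walk A B k (fun n => if n is m.+1 then u m else z)) => //.
- by move=> [|i] ik //; apply: wu.
- move=> [|i] [|j]; rewrite !inE //= => ik jk.
  + by move/zneq; case; lia.
  + by move/esym/zneq; case; lia.
  + by move/uinj => -> //; rewrite inE /=; lia.
(* Before its last vertex the walk avoids [B], hence stays in [A]. *)
- move=> [|i] ik //.
  by have := uG i (ltnW ik); rewrite VG => -[|/nB]//; case.
Qed.

(** The edge sets agree by construction, and since [G] has a vertex, the inclusion already yields an
    edge. *)
Lemma noniso_graph_eqP : noniso_graph_eq G <-> vset G `<=` noniso_vset G.
Proof.
split=> [[nG eqG] x|sub]; first by rewrite -{1}eqG.
have nG : nonempty_graph G.
  have [x xG] := vset_nonempty G; have [_ /existsNP[y]] := sub x xG.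
  by move=> /not_implyP[_ /contrapT xy]; exists [set x; y].
exists nG; have VE : noniso_vset G = vset G by apply/seteqP; split=> // x [].
(* The proof fields are generalized so that the vertex set can be rewritten; proof irrelevance then
   identifies them. *)
rewrite /noniso_graph; move: (noniso_nonempty nG) (@edge_noniso _ G).
rewrite VE; case: G => V E p q /= p' q'.
by rewrite (Prop_irrelevance p' p) (Prop_irrelevance q' q).
Qed.

End Walks.

Lemma be_pathC (U : Type) (A B : set U) P : be_path A B P -> be_path B A P.
Proof.
move=> [pP sP [e [[eP Ae Be] eu]]]; split=> //; first by rewrite setUC.
by exists e; split=> // f [fP Bf Af]; apply: eu.
Qed.

Unset Implicit Arguments.

Theorem corollary2p12 (U : Type) (G : graph U)
    (hG : forall x : U, vset G <> [set x]) :
  (forall A B : set U,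
      A `<=` vset G -> B `<=` vset G ->
      A !=set0 -> B !=set0 -> A `&` B = set0 -> vset G = A `|` B ->
      path_bipartite G A B)
  <->
  (connected_graph G /\ noniso_graph_eq G).
Proof.
split=> [pbG|[cG /noniso_graph_eqP nG] A B _ _ A0 B0 AB VG].
  have pbS S : S `<=` vset G -> S !=set0 -> (vset G `\` S) !=set0 ->
      path_bipartite G S (vset G `\` S).
    move=> sS S0 nS; apply: pbG => //.
    - by rewrite setDE setICA setICr setI0.
    - by rewrite setDUK.
  split.
    move=> x y xG yG xy; pose C := [set z | vset G z /\ exists k, walk_between G [set x] [set z] k].
    have [[_ [k0 w0]]|nCy] := pselect (C y).
      have [k [u [wu uinj [/= u0 uk] _ _]]] := shortest_walk w0.
      have k1 : (1 <= k)%N by case: k uk {wu uinj} => // uk; case: xy; rewrite -uk u0.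
      have [P [nP sP]] := path_of_walk k1 wu uinj.
      by exists P; split=> //; exists k, u.
    have [|||_ _ [F [[P FP] Fbe [_ EG]]]] := pbS C; first by move=> z [].
    - by exists x; split=> //; exists 0%N, (fun=> x).
    - by exists y.
    (* The crossing edge of any be-path in the family leads from a reachable [a] to an unreachable
       [b]. *)
    have [_ _ [e [[eP [a [[aG [k [u [wu u0 uk]]]] ea]] [b [[bG nCb] eb]]] _]]] := Fbe _ FP.
    have eG : eset G e by rewrite EG; exists P.
    case: nCb; split=> //.
    have [ab|ab] := pselect (a = b); first by exists k, u; split=> //; rewrite -ab.
    have eab : e = [set a; b].
      have [c [d [_ _ _ ecd]]] := eset_pair eG; move: ea eb; rewrite ecd.
      move=> [ac|ad] [bc|bd]; [by case: ab; rewrite ac bc| | |by case: ab; rewrite ad bd].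
      - by rewrite ac bd.
      - by rewrite ad bc setUC.
    (* Extending the walk to [a] by the edge [e] reaches [b], a contradiction. *)
    exists k.+1, (fun n => if (n <= k)%N then u n else b); split=> //; last by rewrite ltnn.
    move=> i ik; rewrite -ltnS ik; case: ltnP => ik'; first exact: wu.
    have -> : i = k by lia.
    by rewrite uk /adjacent -eab.
  apply/noniso_graph_eqP => x xG; split=> // iso.
  have [|||_ _ [F [_ Fbe [VG EG]]]] := pbS [set x]; first by move=> _ ->.
  - by exists x.
  (* The complement of [x] is nonempty because [hG] excludes a one-vertex graph. *)
  - apply: contrapT => /set0P/negP/negPn/eqP; rewrite setD_eq0 => sx.
    by apply: (hG x); apply/seteqP; split=> // _ ->.
  have : vset G x by [].
  rewrite VG => -[P FP]; have [[k [u [k1 _ VP EP]]] _ _] := Fbe _ FP.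
  rewrite VP => -[i /= ik uix].
  have [y xy] : exists y, adjacent G x y.
    have uG j : (j < k)%N -> adjacent G (u j) (u j.+1).
      by move=> jk; rewrite /adjacent EG; exists P => //; rewrite EP; exists j.
    (* The first vertex of the path has its successor as a neighbour, every other vertex its
       predecessor. *)
    rewrite -uix; case: i ik {uix} => [|i] ik; first by exists (u 1%N); apply: uG.
    by exists (u i); apply: adjacentC; apply: uG.
  by apply: (iso y) => //; apply: (edge_vset xy); right.
have thr e : eset G e -> exists P, [/\ be_path A B P, subgraph P G & eset P e].
  move=> eG; have [x [y [xG yG xy exy]]] := eset_pair eG.
  rewrite {}exy in eG *; move: xG; rewrite VG => -[Ax|Bx].
    exact: be_path_through.
  (* With [x] in [B], exchange the roles of [A] and [B]. *)
  have [||P [/be_pathC ? ? ?]] := be_path_through cG _ _ A0 Bx eG.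
  - by rewrite setUC.
  - by rewrite setIC.
  - by exists P.
have thrx x : vset G x -> exists P, [/\ be_path A B P, subgraph P G & vset P x].
  move=> /nG[_ /existsNP[y /not_implyP[_ /contrapT xy]]].
  have [P [? ? eP]] := thr _ xy; exists P; split=> //.
  by apply: (edge_vset eP); left.
split; [by rewrite VG; left|by rewrite VG; right|].
(* The family of all be-paths inside [G]: its union lies in [G] by choice, and [thrx] and [thr] show
   that it covers every vertex and edge. *)
exists [set P | be_path A B P /\ subgraph P G]; split.
- by have [x /thrx[P [? ? _]]] := vset_nonempty G; exists P.
- by move=> P [].
- split; apply/seteqP; split=> [x|x [P [_ [sV sE]]]].
  + by move=> /thrx[P [? ? ?]]; exists P.
  + exact: sV.
  + by move=> /thr[P [? ? ?]]; exists P.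
  + exact: sE.
Qed.
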